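(* Let $X$ be a non-locally-compact abelian Polish group and let $G$ be a $\sigma$-compact subgroup of $X$. Then there exists a $G$-invariant $F_\sigma$ subset $F$ of $X$ such that $F$ is neither prevalent nor Haar-null. In particular, this holds if $G$ is a countable dense subgroup of $X$.
   Context: A universally measurable set $A\subseteq X$ is called Haar-null if there exists a Borel probability measure $\mu$ on $X$ such that $\mu(x+A)=0$ for every $x\in X$ (measures are extended to universally measurable sets via completion). A set is called prevalent if its complement in $X$ is Haar-null. A set $F\subseteq X$ is $G$-invariant if $g+F=F$ for every $g\in G$. *)

(* Defs.v *)
(* MathComp-Analysis. *)
From HB Require Import structures.
From mathcomp Require Import all_boot all_order all_algebra.
From mathcomp Require Import all_classical all_reals all_analysis.
From mathcomp Require Import measurable_realfun borel_hierarchy.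

Set Implicit Arguments.
Unset Strict Implicit.
Unset Printing Implicit Defensive.

Import Order.TTheory GRing.Theory Num.Theory.
Import numFieldNormedType.Exports.

Local Open Scope classical_set_scope.
Local Open Scope ring_scope.

Definition separable_space (T : topologicalType) : Prop :=
  exists2 D : set T, countable D & dense D.

Definition completely_metrizable (R : realType) (T : topologicalType) : Prop :=
  exists M : metricType R,
    (forall F : set_system M, ProperFilter F -> cauchy F ->
       exists x : M, F --> x) /\
    exists (f : T -> M) (g : M -> T),
      [/\ continuous f, continuous g, cancel f g & cancel g f].

Definition polish (R : realType) (T : topologicalType) : Prop :=
  separable_space T /\ completely_metrizable R T.

Definition sigma_compact (T : topologicalType) (A : set T) : Prop :=
  exists2 K : (set T)^nat, (forall n, compact (K n)) & A = \bigcup_n K n.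

Section haar_null.
Context (R : realType) (X : topologicalZmodType).

(* [X] with its Borel sigma-algebra. Measurable types are pointed; the choice of
   [0] as base point is immaterial. *)
Definition borelType : Type := X.
HB.instance Definition _ := Choice.on borelType.
HB.instance Definition _ := isPointed.Build borelType (0 : X).
HB.instance Definition _ := Measurable.copy borelType
  (@g_sigma_algebraType borelType (@open X)).

Definition translate (x : X) (A : set X) : set X := [set x + a | a in A].

Definition invariant_set (G F : set X) : Prop :=
  forall g, G g -> translate g F = F.

(* [completed_algebra_gen mu] consists of the sets [B `|` N] with [B] Borel and
   [N] contained in a Borel set of [mu]-measure zero. *)
Definition universally_measurable (A : set X) : Prop :=
  forall mu : probability borelType R, completed_algebra_gen mu A.

(* [completed_measure_extension mu] is the outer measure induced by [mu]; on the
   sets of [completed_algebra_gen mu] it is the completion of [mu]. *)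
Definition Haar_null (A : set X) : Prop :=
  universally_measurable A /\
  exists mu : probability borelType R,
    forall x, @completed_measure_extension _ _ _ mu (translate x A) = 0%E.

Definition prevalent (A : set X) : Prop := Haar_null (~` A).

End haar_null.

(* Main.v *)
Require Import Defs.
From HB Require Import structures.
From mathcomp Require Import all_boot all_order all_algebra.
From mathcomp Require Import all_classical all_reals all_analysis.
From mathcomp Require Import measurable_realfun borel_hierarchy.
From mathcomp Require Import zify ring lra.

(** The set is [F = A + G] for a closed set [A] such that [A + G] is disjoint from
    a second set [B], where both [A] and [B] contain a translate of every compact
    set.  If [G] is the union of compact sets [K n], then [F] is the union of the
    sets [A + K n], which are closed ([closed_addr_compact]).  By Ulam's theorem a
    Borel probability measure on a Polish space charges a compact set, hence
    neither [A] nor [B] is Haar-null, and neither is [F] nor its complement.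

    To build [A] and [B], fix a dense sequence [q]
    and a decreasing base [V] of neighbourhoods of [0].  A totally bounded set is
    contained in a set [slalom a], with [a : nat -> nat], of the points that for
    every [n] are [V (8 * n + 5)]-close to one of [q 0], ..., [q (a n)].  So it is
    enough to place a translate [t + slalom a] of each slalom in [A], and another
    one in [B].  The vectors [t] are sums of series whose [n]-th term depends on
    the first [n.+1] values of [a] only, so that countably many terms have to be
    chosen at each level, and lies in [V (8 * n)].  As the group is not locally
    compact, no neighbourhood of [0] is totally bounded ([nlc_not_fin_covered]),
    and [V] can be chosen so that [V n] is not covered by finitely many translates
    of [V n.+1].  The terms of level [n] are picked one after the other: each of
    them has to avoid the values that would make [A + K n] meet [B], and for each
    earlier term these values are covered by finitely many translates of
    [V (8 * n + 1)], because [K n] is compact and the slaloms are controlled by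
    finitely many points of [q] at that level.  Hence a choice in [V (8 * n)]
    remains ([separated_choice], [separated_tree], [separated_slaloms]).

    The series converge because an abelian group that is completely metrizable as
    a space is complete as a group ([group_cauchy_cvg], a theorem of Klee). *)

Set Implicit Arguments.
Unset Strict Implicit.
Unset Printing Implicit Defensive.

Import Order.TTheory GRing.Theory Num.Theory.
Import numFieldNormedType.Exports.

Local Open Scope classical_set_scope.
Local Open Scope ring_scope.

(** * Neighbourhoods and finite coverings in a topological group *)

Section group_topology.
Variable X : topologicalZmodType.
Implicit Types (U V : set X) (x y : X).

Lemma cvg_translate x y : x + z @[z --> y] --> x + y.
Proof.
apply: (@continuous_comp _ _ _ (fun z => (x, z)) (fun p : X * X => p.1 + p.2)).
  by apply: cvg_pair; [exact: cvg_cst|exact: cvg_id].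
exact: (@add_continuous X).
Qed.

Lemma nbhs_translate x U : nbhs x U <-> nbhs 0 [set u | U (x + u)].
Proof.
split=> [xU|]; first by have := @cvg_translate x 0; rewrite addr0 => /(_ _ xU).
have := @cvg_translate (- x) x; rewrite addNr => cx /cx cU.
suff <- : [set z | U (x + (- x + z))] = U by [].
by apply/funext => z /=; rewrite addNKr.
Qed.

Lemma nbhs_subr x U : nbhs 0 U -> nbhs x [set y | U (y - x)].
Proof.
move=> U0; apply/nbhs_translate; rewrite (_ : [set u | _] = U)//.
by apply/funext => u; rewrite /= addrAC subrr add0r.
Qed.

Lemma subr_continuous x : continuous (fun y => y - x).
Proof.
rewrite (_ : (fun y => y - x) = +%R (- x)).
  by move=> y; exact: cvg_translate.
by apply/funext => y; rewrite addrC.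
Qed.

Lemma group_cvgD (a b : X^nat) x y :
  a @ \oo --> x -> b @ \oo --> y -> a n + b n @[n --> \oo] --> x + y.
Proof.
move=> ax by_.
apply: (@cvg_comp _ _ _ (fun n => (a n, b n)) (fun z : X * X => z.1 + z.2)).
  exact: cvg_pair ax by_.
exact: (@add_continuous X (x, y)).
Qed.

(** A set halving the whole group is just an open symmetric neighbourhood of
    [0]; see [nbhs_chain]. *)
Definition halves V U := [/\ open V, V 0, forall v, V v -> V (- v) &
  forall v w, V v -> V w -> U (v + w)].

Lemma nbhs0_halves U : nbhs 0 U -> exists V, halves V U.
Proof.
move=> U0.
have := @add_continuous X (0, 0); rewrite /continuous_at /= addr0.
move=> /(_ _ U0)[[A B]] /= [A0 B0] ABU.
have : nbhs (0 : X) (A `&` B) by exact: filterI.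
rewrite nbhsE => -[D [oD D0] DAB].
exists (D `&` -%R @^-1` D); split.
- apply: openI => //; apply: open_comp => // z _; exact: opp_continuous.
- by split => //=; rewrite oppr0.
- by move=> v [? ?]; split => //=; rewrite opprK.
- by move=> v w [/DAB[Av _] _] [/DAB[_ Bw] _]; apply: (ABU (v, w)).
Qed.

(** Sequences suffice to speak of completeness because the groups below are
    first countable. *)
Definition group_cauchy (x : X^nat) := forall U, nbhs 0 U ->
  exists N, forall m n, (N <= m)%N -> (N <= n)%N -> U (x m - x n).

(** Coverability by finitely many translates of [W]; asking it for every
    neighbourhood [W] of [0] is total boundedness. *)
Definition fin_covered (W C : set X) :=
  exists s : seq X, forall c, C c -> exists2 a, a \in s & W (c - a).

Lemma fin_coveredS W C D : C `<=` D -> fin_covered W D -> fin_covered W C.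
Proof. by move=> CD [s sD]; exists s => c /CD/sD. Qed.

Lemma fin_coveredU W C D :
  fin_covered W C -> fin_covered W D -> fin_covered W (C `|` D).
Proof.
move=> [s sC] [t tD]; exists (s ++ t) => c [/sC|/tD] [a sa Wa];
  by exists a => //; rewrite mem_cat sa ?orbT.
Qed.

Lemma fin_covered_bigcup (I : eqType) (r : seq I) W (C : I -> set X) :
  (forall i, i \in r -> fin_covered W (C i)) ->
  fin_covered W [set c | exists2 i, i \in r & C i c].
Proof.
elim: r => [|i r IH] rC; first by exists [::] => c [].
apply: (@fin_coveredS _ _ (C i `|` [set c | exists2 j, j \in r & C j c])).
  by move=> c [j]; rewrite inE => /predU1P[->|jr] Cc; [left|right; exists j].
apply: fin_coveredU; first by apply: rC; rewrite mem_head.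
by apply: IH => j jr; apply: rC; rewrite inE jr orbT.
Qed.

Lemma fin_covered_translate W C x :
  fin_covered W C -> fin_covered W [set c | C (c - x)].
Proof.
move=> [s sC]; exists (map (+%R x) s) => c /= /sC[a sa Wa].
by exists (x + a); [exact: map_f|rewrite opprD addrA].
Qed.

Lemma fin_coveredN W C : (forall w, W w -> W (- w)) ->
  fin_covered W C -> fin_covered W [set c | C (- c)].
Proof.
move=> WN [s sC]; exists (map -%R s) => c /= /sC[a sa Wa].
exists (- a); first exact: map_f.
by have := WN _ Wa; rewrite opprD opprK.
Qed.

Lemma compact_fin_covered W C : open W -> W 0 -> compact C -> fin_covered W C.
Proof.
move=> oW W0 /compact_near_coveringP cC.
(* the filter of all finite lists that contain a given finite list *)
pose F := filter_from [set: seq X] (fun s => [set t : seq X | {subset s <= t}]).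
have FF : Filter F.
  apply: filter_from_filter; first by exists [::].
  move=> s t _ _; exists (s ++ t) => // r st; split => a ra; apply: st;
    by rewrite mem_cat ra ?orbT.
have /(_ _)[|s _ sC] := cC _ F (fun s x => exists2 a, a \in s & W (x - a)) FF.
  move=> x Cx; exists ([set x' | W (x' - x)], [set s : seq X | x \in s]).
    split => /=; last by exists [:: x] => // s; apply; rewrite mem_head.
    by apply: nbhs_subr; exact: open_nbhs_nbhs.
  by move=> [x' s] /= [Wx xs]; exists x.
by exists s => c Cc; exact: (sC s).
Qed.

Lemma closed_addr_compact (A K : set X) : closed A -> compact K ->
  closed [set z | exists a g, [/\ A a, K g & z = a + g]].
Proof.
move=> cA /compact_near_coveringP cK; rewrite -openC; rewrite openE => z nz.
have : nbhs z [set z' | K `<=` [set g | ~ A (z' - g)]].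
  apply: (cK X (nbhs z) (fun z' g => ~ A (z' - g))).
  move=> g Kg; have zg : nbhs (z - g) (~` A).
    apply: open_nbhs_nbhs; split; first exact: closed_openC.
    by move=> Azg; apply: nz; exists (z - g), g; split => //; rewrite subrK.
  have [[B D] /= [Bz Dg] BD] := @sub_continuous X (z, g) _ zg.
  by exists (D, B) => // -[g' z'] /= [Dg' Bz']; exact: (BD (z', g')).
apply: filterS => z' Kz' [a [g [Aa Kg z'E]]].
by apply: (Kz' g Kg); rewrite z'E addrK.
Qed.

End group_topology.

(** * A completely metrizable abelian group is complete *)

Lemma ball_geometric_cvg (R : realType) (M : metricType R) (y : nat -> M) :
  (forall F : set_system M, ProperFilter F -> cauchy F ->
     exists x : M, F --> x) ->
  (forall k, ball (y k) (2^-1 ^+ k.+1) (y k.+1)) -> exists l : M, y @ \oo --> l.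
Proof.
move=> complete yB; apply: complete; apply: cauchy_exP => e e0.
have yBm m : forall n, ball (y n) (2^-1 ^+ n) (y (n + m)%N).
  elim: m => [n|m IH n].
    by rewrite addn0; apply: ballxx; rewrite exprn_gt0.
  have -> : 2^-1 ^+ n = 2^-1 ^+ n.+1 + 2^-1 ^+ n.+1 :> R.
    by rewrite exprS; field.
  by apply: ball_triangle (yB n) _; rewrite addnS -addSn.
have /cvgrPdist_lt/(_ e e0) : (2^-1 ^+ n : R) @[n --> \oo] --> 0.
  by rewrite exprn_geometric; apply: cvg_geometric; rewrite ger0_norm; lra.
move=> [n _ /(_ n (leqnn n))]; rewrite /= sub0r normrN.
rewrite ger0_norm ?exprn_ge0// => ne.
exists (y n); exists n => // k nk /=.
by rewrite -(subnKC nk); apply: le_ball (yBm _ _); exact: ltW.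
Qed.

Section completeness.
Variables (R : realType) (X : topologicalZmodType).
Hypothesis cX : completely_metrizable R X.

Lemma nbhs0_countable_base :
  exists B : (set X)^nat, (forall n, nbhs 0 (B n)) /\
    forall U, nbhs 0 U -> exists n, B n `<=` U.
Proof.
have [M [_ [f [g [cf cg fK gK]]]]] := cX.
exists (fun n => f @^-1` ball (f 0) (2^-1 ^+ n)); split=> [n|U U0].
  by apply: cf; apply: nbhsx_ballx; rewrite exprn_gt0.
have : nbhs (f 0) (g @^-1` U) by apply: cg; rewrite fK.
move=> /nbhs_ballP[e /= e0 eU].
have /cvgrPdist_lt/(_ e e0) : (2^-1 ^+ n : R) @[n --> \oo] --> 0.
  by rewrite exprn_geometric; apply: cvg_geometric; rewrite ger0_norm; lra.
move=> [n _ /(_ n (leqnn n))]; rewrite /= sub0r normrN.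
rewrite ger0_norm ?exprn_ge0// => ne.
exists n => u /= Bu; rewrite -[u]fK; apply: eU.
by apply: le_ball Bu; exact: ltW.
Qed.

(** The complete metric need not be invariant, so a Cauchy sequence of the group
    need not be Cauchy for it.  The proof extracts a subsequence [x (n k)] and
    puts [p k.+1 = x (n k.+1) - p k]; then
    [p k.+2 = p k + (x (n k.+2) - x (n k.+1))], where the difference can be made
    small after [p k] is known, hence small for the metric at [p k].  So the even
    and the odd terms of [p] converge for the metric, and [x (n k.+1)], which is
    [p k.+1 + p k], converges to the sum of their limits. *)
Lemma group_cauchy_cvg (x : X^nat) :
  group_cauchy x -> exists l : X, x @ \oo --> l.
Proof.
move=> xC; have [M [complete [f [g [cf cg fK gK]]]]] := cX.
(* [N (p, k)]: from this index on, increments of [x] move [p] by less than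
   [2^-k.+1] for the metric *)
have /choice[N NP] : forall pk : X * nat, exists N, forall m n,
    (N <= m)%N -> (N <= n)%N ->
    ball (f pk.1) (2^-1 ^+ pk.2.+1) (f (pk.1 + (x m - x n))).
  move=> [p k] /=; suff /nbhs_translate/xC : nbhs p
    (f @^-1` ball (f p) (2^-1 ^+ k.+1)) by [].
  by apply: cf; apply: nbhsx_ballx; rewrite exprn_gt0.
pose step k (pn : X * nat) :=
  let n := maxn pn.2 (N (pn.1, k./2)) in (x n.+1 - pn.1, n.+1).
pose s := fix s k := if k is k'.+1 then step k' (s k') else (x 0%N, 0%N).
pose p k := (s k).1; pose n k := (s k).2.
have pS k : p k.+1 + p k = x (n k.+1) by rewrite /p /n /= subrK.
have nS k : (n k < n k.+1)%N by rewrite /n /= ltnS leq_max leqnn.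
have nN k : (N (p k, k./2) <= n k.+1)%N.
  by rewrite /n /= ltnW// ltnS leq_max leqnn orbT.
have pB k : ball (f (p k)) (2^-1 ^+ (k./2).+1) (f (p k.+2)).
  have -> : p k.+2 = p k + (x (n k.+2) - x (n k.+1)).
    rewrite -!pS [p k.+1 + p k]addrC opprD addrACA subrr addr0.
    by rewrite addrCA subrr addr0.
  apply: (NP (p k, k./2)); last exact: nN.
  by rewrite (leq_trans (nN k))// ltnW.
have sub_cvg (i : nat) : (i < 2)%N ->
    exists l : X, (p (k.*2 + i)%N) @[k --> \oo] --> l.
  move=> i2.
  have [|l fl] :=
    @ball_geometric_cvg _ _ (fun k => f (p (k.*2 + i)%N)) complete.
    move=> k; rewrite doubleS !addSn; have := pB (k.*2 + i)%N.
    by rewrite (_ : (_ + i)./2 = k)//; lia.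
  exists (g l); have := cvg_comp _ _ fl (cg l).
  by rewrite (_ : g \o _ = fun k => p (k.*2 + i)%N)//; apply/funext => k /=.
have [a pa] := sub_cvg 0%N isT; have [b pb] := sub_cvg 1%N isT.
exists (b + a) => U U0.
have /nbhs_translate/nbhs0_halves[V [oV V0 VN VV]] := U0.
have V0' : nbhs 0 V by exact: open_nbhs_nbhs.
have xab : x (n k.*2.+1) @[k --> \oo] --> b + a.
  rewrite (_ : (fun k => _) = (fun k => p (k.*2 + 1)%N + p (k.*2 + 0)%N)).
    exact: group_cvgD.
  by apply/funext => k; rewrite -pS addn1 addn0.
have [N1 N1P] := xC _ V0'.
have [N2 _ N2P] := xab _ (nbhs_subr (b + a) V0').
have kn k : (k <= n k)%N by elim: k => // k IH; exact: leq_ltn_trans (nS k).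
exists N1 => // m /= N1m; pose y := x (n (maxn N1 N2).*2.+1).
have -> : x m = b + a + ((x m - y) + (y - (b + a))).
  by rewrite [x m - y + _]addrA subrK addrCA subrr addr0.
apply: VV.
  by apply: N1P => //; apply: leq_trans (kn _); lia.
by apply: (N2P (maxn N1 N2)); exact: leq_maxr.
Qed.

End completeness.

(** * Chains of neighbourhoods and total boundedness *)

Section chains.
Variables (R : realType) (X : topologicalZmodType).
Hypothesis cX : completely_metrizable R X.

(** A base of open symmetric neighbourhoods of [0], each of which contains the
    sum of the next one with itself: a substitute for an invariant metric. *)
Definition nbhs_chain (V : (set X)^nat) :=
  [/\ forall n, halves (V n) [set: X], forall n, halves (V n.+1) (V n) &
      forall U, nbhs 0 U -> exists n, V n `<=` U].

(** The operator [E] forces each term to be as small as desired compared with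
    the previous one. *)
Lemma exists_chain (E : set X -> set X) :
  (forall U, nbhs 0 U -> nbhs 0 (E U)) ->
  exists V, nbhs_chain V /\ forall n, V n.+1 `<=` E (V n).
Proof.
move=> E0; have [B [B0 Bbase]] := nbhs0_countable_base cX.
have /choice[h hP] : forall U : set X, exists V, nbhs 0 U -> halves V U.
  move=> U; have [U0|U0] := pselect (nbhs 0 U); last by exists setT.
  by have [V VU] := nbhs0_halves U0; exists V.
pose next n U := h (U `&` B n `&` E U).
pose V := fix V n := if n is m.+1 then next m (V m) else h setT.
have V0 n : nbhs 0 (V n).
  elim: n => [|n IH] /=.
    have [oV V0 _ _] : halves (h setT) [set: X] by apply: hP; exact: filterT.
    exact: open_nbhs_nbhs.
  have [oV V0' _ _] : halves (next n (V n)) (V n `&` B n `&` E (V n)).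
    by apply: hP; apply: filterI; [exact: filterI|exact: E0].
  exact: open_nbhs_nbhs.
have VS n : halves (V n.+1) (V n `&` B n `&` E (V n)).
  by apply: hP; apply: filterI; [exact: filterI|exact: E0].
have Vsub n : V n.+1 `<=` V n `&` B n `&` E (V n).
  by have [_ V0' _ VV] := VS n => v Vv; rewrite -[v]addr0; exact: VV.
exists V; split; last by move=> n v /Vsub[].
split.
- move=> [|n]; first by apply: hP; exact: filterT.
  by have [oV V0' VN _] := VS n; split.
- move=> n; have [oV V0' VN VV] := VS n; split => // v w Vv Vw.
  by have [[]] := VV _ _ Vv Vw.
- by move=> U /Bbase[n BU]; exists n.+1 => v /Vsub[[_ /BU]].
Qed.

Section chain_theory.
Variable V : (set X)^nat.
Hypothesis VC : nbhs_chain V.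

Lemma chain_open n : open (V n). Proof. by have [/(_ n)[]] := VC. Qed.
Lemma chain0 n : V n 0. Proof. by have [/(_ n)[]] := VC. Qed.
Lemma chainN n v : V n v -> V n (- v).
Proof. by have [/(_ n)[_ _ + _] _ _] := VC; apply. Qed.
Lemma chainD n v w : V n.+1 v -> V n.+1 w -> V n (v + w).
Proof. by have [_ /(_ n)[_ _ _ +] _] := VC; apply. Qed.
Lemma chainB n v w : V n.+1 v -> V n.+1 w -> V n (v - w).
Proof. by move=> Vv /chainN; exact: chainD. Qed.
Lemma chain_nbhs n : nbhs 0 (V n).
Proof. by apply: open_nbhs_nbhs; split; [exact: chain_open|exact: chain0]. Qed.

Lemma chain_nbhsP x U : nbhs x U -> exists n, forall y, V n (y - x) -> U y.
Proof.
have [_ _ base] := VC; move=> /nbhs_translate/base[n VU].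
by exists n => y /VU /=; rewrite addrCA subrr addr0.
Qed.

Lemma chain_le m n : (m <= n)%N -> V n `<=` V m.
Proof.
move=> /subnKC <-; elim: (n - m)%N => [|k IH]; first by rewrite addn0.
rewrite addnS => v Vv; apply: IH; rewrite -[v]addr0.
by apply: chainD => //; exact: chain0.
Qed.

Lemma chain_cauchy_cvg (x : X^nat) :
  (forall N m n, (N < m)%N -> (N < n)%N -> V N (x m - x n)) ->
  exists l : X, x @ \oo --> l.
Proof.
move=> xV; apply: (group_cauchy_cvg cX) => U; have [_ _ base] := VC.
by move=> /base[N VU]; exists N.+1 => m n *; exact/VU/xV.
Qed.

(** The sum of a series whose [i]-th term lies in [V (8 * i)] exists, and its
    tail after the term of index [n] lies in [V (8 * n + 6)].  The step [8]
    leaves room to add several such tails and other errors of the same size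
    within [V (8 * n + 1)]. *)
Lemma chain_series_cvg (x : X^nat) :
  (forall n, V (8 * n)%N (x n.+1 - x n)) ->
  exists t, forall n, V (8 * n + 6)%N (t - x n.+1).
Proof.
move=> xV.
have tail k : forall n, V (8 * n + 7)%N (x (n.+1 + k)%N - x n.+1).
  elim: k => [n|k IH n]; first by rewrite addn0 subrr; exact: chain0.
  rewrite (_ : n.+1 + k.+1 = n.+2 + k)%N; last by lia.
  rewrite -(subrK (x n.+2) (x (n.+2 + k)%N)) -addrA.
  apply: chainD.
    by apply: chain_le (IH n.+1); lia.
  by apply: chain_le (xV n.+1); lia.
have [t xt] : exists t : X, x @ \oo --> t.
  apply: chain_cauchy_cvg => N m n mN nN.
  rewrite -(subrK (x N.+1) (x m)) -addrA -[_ - x n]opprB.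
  have := tail (m - N.+1)%N N; have := tail (n - N.+1)%N N.
  rewrite !subnKC// => Vn Vm; apply: (@chain_le _ (8 * N + 6)%N); first by lia.
  by apply: chainB; [move: Vm|move: Vn]; apply: chain_le; lia.
exists t => n; have [k _ kP] := xt _ (nbhs_subr t (chain_nbhs (8 * n + 7)%N)).
rewrite -(subrK (x (n.+1 + k)%N) t) -addrA; apply: chainD.
  rewrite -opprB; apply: chainN; apply: chain_le (kP (n.+1 + k)%N _).
    by lia.
  by rewrite /=; lia.
by apply: chain_le (tail k n); lia.
Qed.

End chain_theory.

Lemma ultra_fin_covered (F : set_system X) (W C : set X) : UltraFilter F ->
  F C -> fin_covered W C -> exists a, F [set c | W (c - a)].
Proof.
move=> UF FC [s sC]; have PF : ProperFilter F := ultra_proper.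
have {FC sC} : F [set c | exists2 a, a \in s & W (c - a)] by exact: filterS FC.
elim: s => [|a s IH].
  by move=> /filter_ex[x []].
have [Fa _|Fa Fs] := @in_ultra_setVsetC _ F [set c | W (c - a)] UF.
  by exists a.
apply: IH; apply: filterS (filterI Fa Fs) => c [/= Wa [b]].
by rewrite inE => /predU1P[->//|bs Wb]; exists b.
Qed.

(** An ultrafilter on a totally bounded set contains translates of arbitrarily
    small neighbourhoods; points chosen in their successive intersections form
    a Cauchy sequence, whose limit is a limit of the ultrafilter. *)
Lemma totally_bounded_compact (C : set X) : closed C ->
  (forall W, nbhs 0 W -> fin_covered W C) -> compact C.
Proof.
move=> cC C_tb; rewrite compact_ultra => F UF FC.
have [V [VC _]] := @exists_chain (fun=> setT) (fun _ _ => filterT).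
have /choice[c cP] : forall n, exists a, F [set c | V n (c - a)].
  by move=> n; apply: ultra_fin_covered FC (C_tb _ _); exact: chain_nbhs.
have FI n : F [set z | forall i, (i <= n)%N -> V i (z - c i)].
  elim: n => [|n IH].
    by apply: filterS (cP 0%N) => z Vz i; rewrite leqn0 => /eqP ->.
  apply: filterS (filterI IH (cP n.+1)) => z [zi zn] i.
  by rewrite leq_eqVlt => /predU1P[->//|]; exact: zi.
have /choice[x xP] : forall n, exists z, forall i, (i <= n)%N -> V i (z - c i).
  by move=> n; exact: filter_ex (FI n).
have [l xl] : exists l : X, x @ \oo --> l.
  apply: (chain_cauchy_cvg VC) => N m n mN nN.
  rewrite -(subrK (c N.+1) (x m)) -addrA -[_ - x n]opprB.
  by apply: (chainB VC); exact: xP.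
have Fl : F --> l.
  move=> U /(chain_nbhsP VC)[N NU].
  have [k _ kP] := xl _ (nbhs_subr l (chain_nbhs VC N.+1)).
  apply: filterS (cP N.+2) => z Vz; apply: NU.
  rewrite -(subrK (x (maxn k N.+2)) z) -addrA; apply: chainD => //.
    rewrite -(subrK (c N.+2) z) -addrA -[_ - x _]opprB; apply: chainB => //.
    by apply: xP; exact: leq_maxr.
  by apply: kP; exact: leq_maxl.
exists l; split => //; apply: cC => B /Fl FB.
exact: filter_ex (filterI FC FB).
Qed.

(** Otherwise [U] would be totally bounded, and so would the closure of a
    neighbourhood halving [U]: this closure is compact and its translates would
    make the group locally compact. *)
Lemma nlc_not_fin_covered (U : set X) : ~ locally_compact [set: X] ->
  nbhs 0 U -> exists2 W, nbhs 0 W & ~ fin_covered W U.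
Proof.
move=> nlc U0; apply: contrapT => noW; apply: nlc => x _.
have Utb W : nbhs 0 W -> fin_covered W U.
  by move=> W0; apply: contrapT => nW; apply: noW; exists W.
have [V [oV V0 VN VV]] := nbhs0_halves U0.
have V0' : nbhs 0 V by exact: open_nbhs_nbhs.
have clVU : closure V `<=` U.
  move=> z /(_ [set y | V (y - z)])[].
    exact: nbhs_subr.
  move=> y [Vy /VN]; rewrite opprB => Vzy.
  by rewrite -(subrK y z); exact: VV.
have cC : closed [set z | closure V (z - x)].
  apply: (@preimage_closed _ _ (fun z => z - x)); last exact: closed_closure.
  by move=> z _; exact: subr_continuous.
exists [set z | closure V (z - x)]; last split => //.
  by apply: filterS (nbhs_subr x V0') => z Vz _; exact: subset_closure.
apply: totally_bounded_compact => // W W0; apply: fin_covered_translate.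
exact: fin_coveredS clVU (Utb _ W0).
Qed.

End chains.

(** * Tightness of Borel probability measures *)

(** The combinatorial core of Ulam's tightness theorem: choosing [a n] such that
    the complement of [D n (a n)] has measure at most [2^-(n + 2)], the
    complement of the intersection has measure at most [1/2]. *)
Lemma ulam_selection d (T : measurableType d) (R : realType)
    (mu : probability T R) (D : nat -> nat -> set T) :
  (forall n k, measurable (D n k)) ->
  (forall n, nondecreasing_seq (D n)) ->
  (forall n, \bigcup_k D n k = setT) ->
  exists a : nat -> nat, (0 < mu (\bigcap_n D n (a n)))%E.
Proof.
move=> mD ndD DT.
have /choice[a aP] : forall n, exists k,
    (mu (~` D n k) <= (2^-1 / (2 ^ (n + 1))%:R)%:E :> \bar R)%E.
  move=> n; set e := 2^-1 / _; have e0 : 0 < e :> R.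
    by rewrite divr_gt0// ?ltr0n ?expn_gt0//; lra.
  have : mu \o D n @ \oo --> 1%E.
    rewrite -(probability_setT mu) -(DT n); apply: nondecreasing_cvg_mu => //.
    exact: bigcupT_measurable.
  move=> /fine_cvgP[_] /cvgrPdist_le/(_ e e0)[k _ /(_ k (leqnn k))] /=.
  rewrite ger0_norm => [ek|]; last first.
    by rewrite subr_ge0 -lee_fin fineK ?fin_num_measure// probability_le1.
  exists k; rewrite probability_setC// -(fineK (fin_num_measure mu _ (mD n k))).
  by rewrite -EFinB lee_fin.
exists a; rewrite ltNge; apply/negP => K0.
have mK : measurable (\bigcap_n D n (a n)) by exact: bigcapT_measurable.
have : (mu (~` \bigcap_n D n (a n)) <= (2^-1 : R)%:E)%E.
  rewrite setC_bigcap.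
  apply: (@le_trans _ _ (\sum_(0 <= n <oo) mu (~` D n (a n)))%E).
    apply: measure_sigma_subadditive => //.
    - by move=> n; apply: measurableC.
    - by apply: bigcupT_measurable => n; apply: measurableC.
  apply: (@le_trans _ _ (\sum_(0 <= n <oo) (2^-1 / (2 ^ (n + 1))%:R)%:E)%E).
    by apply: lee_nneseries => // n _; exact: aP.
  have := @cvg_geometric_eseries_half R (2^-1) 0; rewrite expr0 divr1.
  by move/cvg_lim => <-.
rewrite probability_setC// leeBlDr ?fin_num_measure//.
move=> /le_trans/(_ (leeD2l _ K0)); rewrite addr0 lee_fin; lra.
Qed.

(** * Choosing a tree of well separated points *)

Section selection.
Variable X : topologicalZmodType.

(** Each new point has to avoid finitely many translates of sets [C i j], up to
    sign; these are covered by finitely many translates of [W], so they do not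
    exhaust [U]. *)
Lemma nat_separated_choice (U W : set X) (p : nat -> X)
    (C : nat -> nat -> set X) :
  (forall w, W w -> W (- w)) -> ~ fin_covered W U ->
  (forall i j, fin_covered W (C i j)) ->
  exists x : nat -> X, (forall i, U (x i)) /\ forall i j, (i < j)%N ->
    ~ C i j (p i + x i - (p j + x j)) /\ ~ C j i (p j + x j - (p i + x i)).
Proof.
move=> WN nU Cfin.
(* [g (n, h)]: a choice for index [n] when [h] lists the previous choices *)
have /choice[g gP] : forall nh : nat * seq X, exists z, U z /\
    forall m, (m < nh.1)%N -> let y := nth 0 nh.2 m in
    ~ C m nh.1 (p m + y - (p nh.1 + z)) /\ ~ C nh.1 m (p nh.1 + z - (p m + y)).
  move=> [n h] /=; apply: contrapT => noz; apply: nU.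
  pose y m := p m + nth 0 h m.
  have : fin_covered W [set z | exists2 m, m \in iota 0 n &
      ([set z | C m n (- (z - (y m - p n)))] `|`
       [set z | C n m (z - (y m - p n))]) z].
    apply: fin_covered_bigcup => m _; apply: fin_coveredU.
      have := Cfin m n => /(fin_coveredN WN)/fin_covered_translate; exact.
    by have := Cfin n m => /fin_covered_translate; exact.
  apply: fin_coveredS => z Uz; apply: contrapT => zbad; apply: noz.
  exists z; split => // m mn; split => Cm; apply: zbad; exists m;
    rewrite ?mem_iota ?add0n//.
  - by left; rewrite /= opprB -addrA -opprD.
  - by right; rewrite /= opprB addrA [z + _]addrC.
pose s := fix s n := if n is m.+1 then rcons (s m) (g (m, s m)) else [::].
have size_s n : size (s n) = n by elim: n => //= n IH; rewrite size_rcons IH.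
have sE m n : (m < n)%N -> nth 0 (s n) m = g (m, s m).
  elim: n => // n IH; rewrite ltnS leq_eqVlt /= nth_rcons size_s.
  by move=> /predU1P[->|mn]; [rewrite ltnn eqxx|rewrite mn IH].
exists (fun n => g (n, s n)); split=> [i|i j ij].
  by have [] := gP (i, s i).
by have [_ /(_ i ij)] := gP (j, s j); rewrite /= sE.
Qed.

Lemma separated_choice (I : countType) (U W : set X) (p : I -> X)
    (C : I -> I -> set X) :
  (forall w, W w -> W (- w)) -> ~ fin_covered W U ->
  (forall i j, fin_covered W (C i j)) ->
  exists x : I -> X, (forall i, U (x i)) /\ forall i j, i != j ->
    ~ C i j (p i + x i - (p j + x j)).
Proof.
move=> WN nU Cfin.
pose p' n := if unpickle n is Some i then p i else 0.
pose C' m n := if (unpickle m, unpickle n) is (Some i, Some j) then C i j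
  else set0.
have [|x [xU xC]] := @nat_separated_choice U W p' C' WN nU.
  rewrite /C' => m n; case: unpickle => [i|]; last by exists [::].
  by case: unpickle => [j|]; [exact: Cfin|exists [::]].
exists (fun i => x (pickle i)); split => // i j ij.
have : pickle i != pickle j by apply: contra ij => /eqP/(pcan_inj pickleK) ->.
by rewrite neq_ltn => /orP[|] /xC; rewrite /C' /p' !pickleK => -[].
Qed.

(** One separated choice per level.  A node at level [n.+1] is a boolean, which
    tells two copies of the tree apart, with a list of length [n.+1]; taking all
    lists as indices at every level spares dependent types. *)
Lemma separated_tree (U W : (set X)^nat)
    (C : nat -> bool * seq nat -> bool * seq nat -> set X) :
  (forall n w, W n w -> W n (- w)) -> (forall n, ~ fin_covered (W n) (U n)) ->
  (forall n i j, fin_covered (W n) (C n i j)) ->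
  exists P : nat -> bool * seq nat -> X,
    (forall n i, U n (P n.+1 i - P n (i.1, take n i.2))) /\
    (forall n i j, i != j -> ~ C n i j (P n.+1 i - P n.+1 j)).
Proof.
move=> WN nU Cfin.
have /choice[x xP] : forall np : nat * (bool * seq nat -> X),
    exists x : bool * seq nat -> X, (forall i, U np.1 (x i)) /\
      forall i j, i != j -> ~ C np.1 i j (np.2 i + x i - (np.2 j + x j)).
  move=> [n p]; apply: (@separated_choice _ _ (W n));
    [exact: WN|exact: nU|exact: Cfin].
pose parent n (p : bool * seq nat -> X) i := p (i.1, take n i.2).
pose P := fix P n := if n is m.+1
  then (fun i => parent m (P m) i + x (m, parent m (P m)) i) else fun=> 0.
exists P; split=> [n i|n i j ij] /=.
  by rewrite addrAC subrr add0r; have [] := xP (n, parent n (P n)).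
by have [_ /(_ _ _ ij)] := xP (n, parent n (P n)).
Qed.

End selection.

(** * Two separated sets containing translates of every slalom *)

Lemma separable_seq (X : topologicalZmodType) :
  separable_space X ->
  exists q : X^nat, forall (U : set X) (x : X), nbhs x U -> exists n, U (q n).
Proof.
move=> [D /countable_injP[f finj] dD].
have /choice[q qP] : forall n, exists d, forall d', D d' -> f d' = n -> d' = d.
  move=> n; have [[d [Dd fd]]|nd] := pselect (exists d, D d /\ f d = n).
    by exists d => d' Dd' fd'; apply: finj; rewrite ?inE// fd' fd.
  by exists 0 => d Dd fd; exfalso; apply: nd; exists d.
exists q => U x; rewrite nbhsE => -[B [oB Bx] BU].
have [|d [Bd Dd]] := dD B _ oB; first by exists x.
by exists (f d); rewrite -(qP _ _ Dd erefl); exact: BU.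
Qed.

Lemma subBB (M : zmodType) (a b c d : M) : a - b - (c - d) = a - c - (b - d).
Proof. by rewrite !opprB addrACA [RHS]addrACA [- b + _]addrC. Qed.

Section construction.
Variables (R : realType) (X : topologicalZmodType).
Hypothesis cX : completely_metrizable R X.
Variables (V : (set X)^nat) (q : X^nat) (G : (set X)^nat).
Hypotheses (VC : nbhs_chain V) (VS : forall n, ~ fin_covered (V n.+1) (V n)).
Hypothesis (Gc : forall n, compact (G n)).

Definition net_nbhs (n k : nat) : set X :=
  [set x | exists2 u, (u <= k)%N & V (8 * n + 5)%N (x - q u)].

(** These sets are totally bounded and, when [q] is dense, every totally bounded
    set lies in one of them: they stand for the compact sets. *)
Definition slalom (a : nat -> nat) : set X := \bigcap_n net_nbhs n (a n).

(** Values of [P n.+1 i - P n.+1 j], for the points [P] of a tree, that would let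
    slaloms placed along a branch through [i] and along a branch through [j]
    differ by an element of [G n]; the slack [w] absorbs the approximation
    errors. *)
Definition forbidden n (i j : bool * seq nat) : set X :=
  [set d | exists u v g w,
  [/\ (u <= last 0%N i.2)%N, (v <= last 0%N j.2)%N, G n g,
      V (8 * n + 2)%N w & d = q v - q u - g + w]].

Lemma forbidden_fin_covered n i j :
  fin_covered (V (8 * n + 1)%N) (forbidden n i j).
Proof.
have [s sG] :=
  compact_fin_covered (chain_open VC (8 * n + 2)%N) (chain0 VC _) (@Gc n).
pose r := [seq (u, v) | u <- iota 0 (last 0%N i.2).+1,
                        v <- iota 0 (last 0%N j.2).+1].
apply: (@fin_coveredS _ _ _ [set d | exists2 uv, uv \in r &
  [set d | exists g w, [/\ G n g, V (8 * n + 2)%N w &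
     d = q uv.2 - q uv.1 - g + w]] d]).
  move=> d [u [v [g [w [ui vj Gg Vw dE]]]]]; exists (u, v).
    by apply/allpairsP; exists (u, v); rewrite !mem_iota !add0n !ltnS.
  by exists g, w.
apply: fin_covered_bigcup => -[u v] _; set c := q v - q u.
exists (map (fun a => c - a) s) => d [g [w [Gg Vw ->]]].
have [a sa Va] := sG g Gg; exists (c - a); first exact: map_f.
have -> : c - g + w - (c - a) = w - (g - a).
  by rewrite addrAC subBB subrr add0r addrC.
by rewrite addn1; apply: (chainB VC); rewrite -addn2.
Qed.

(** Two families of branches of one tree: the slalom of [a] is moved by the limit
    [t (b, a)] of the points of the tree along [a], in the copy [b] of the tree.
    If [a' + g = b'] with [a'] close to a point of the first family, [b'] in the
    second one and [g] in [G n], then the two nodes of level [n.+1] differ by an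
    element of [forbidden n], because everything beyond level [n] is small
    compared with [V (8 * n + 1)]. *)
Lemma separated_slaloms : exists A B : set X, [/\ closed A,
  forall n a g, A a -> G n g -> ~ B (a + g),
  forall a, exists t, forall k, slalom a k -> A (t + k) &
  forall a, exists t, forall k, slalom a k -> B (t + k)].
Proof.
have [P [PU PC]] := @separated_tree _ (fun n => V (8 * n)%N)
  (fun n => V (8 * n + 1)%N) forbidden (fun n => @chainN _ _ VC _)
  (fun n => eq_ind_r (fun m => ~ fin_covered (V m) _) (@VS _) (addn1 _))
  forbidden_fin_covered.
have /choice[t tP] : forall ba : bool * (nat -> nat), exists t, forall n,
    V (8 * n + 6)%N (t - P n.+1 (ba.1, mkseq ba.2 n.+1)).
  move=> [b a] /=.
  apply: (chain_series_cvg cX VC (x := fun n => P n (b, mkseq a n))).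
  move=> n; have := PU n (b, mkseq a n.+1); rewrite /= -map_take take_iota.
  by rewrite (minn_idPl _).
pose S b := [set x | exists a k, slalom a k /\ x = t (b, a) + k].
have Sa b a : exists t, forall k, slalom a k -> S b (t + k).
  by exists (t (b, a)) => k ak; exists a, k.
exists (closure (S true)), (S false); split => //.
- exact: closed_closure.
- move=> n z g clz Gg [b [k' [bk' zgE]]].
  have [z' [[a [k [ak z'E]]] /= z'z]] :=
    clz _ (nbhs_subr z (chain_nbhs VC (8 * n + 5)%N)).
  have [u ua ku] := ak n I; have [v vb kv] := bk' n I.
  have := tP (true, a) n; have := tP (false, b) n.
  have lastE c : last 0%N (mkseq c n.+1) = c n by rewrite mkseqS last_rcons.
  rewrite /=; set i := (true, mkseq a n.+1).
  set j := (false, mkseq b n.+1) => tj ti.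
  apply: (PC n i j isT); exists u, v, g.
  (* the slack: two tails of series, two distances to [q] and [z' - z], each of
     them in [V (8 * n + 5)] *)
  set ta := t (true, a) in z'E ti *; set tb := t (false, b) in zgE tj *.
  exists ((tb - P n.+1 j - (ta - P n.+1 i)) + (k' - q v - (k - q u)) +
          (z' - z)).
  split.
  + by rewrite /i lastE.
  + by rewrite /j lastE.
  + by [].
  + have -> : (8 * n + 2 = (8 * n).+2)%N by rewrite addn2.
    apply: (chainD VC); last by apply: (chain_le VC) z'z; lia.
    by apply: (chainD VC); apply: (chainB VC);
      [move: tj|move: ti|move: kv|move: ku]; apply: (chain_le VC); lia.
  + have gE : g = (tb - ta) + (k' - k) + (z' - z).
      rewrite [tb - ta + _]addrACA -opprD -z'E addrA subrK -zgE.
      by rewrite addrAC subrr add0r.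
    rewrite subBB [X in _ = _ + (_ + X + _)]subBB {1}gE.
    set D := q v - q u; set T := tb - ta; set K := k' - k; set f := z' - z.
    set E := P n.+1 j - P n.+1 i.
    have -> : T - E + (K - D) + f = T + K + f - (E + D).
      by rewrite [T - E + _]addrACA -opprD [LHS]addrAC.
    by rewrite addrA subrK opprD addrCA subrr addr0 opprB.
- move=> a; have [t' t'P] := Sa true a.
  by exists t' => k /t'P; exact: subset_closure.
Qed.

End construction.

(** * Sets containing translates of every slalom are not Haar-null *)

Section haar.
Variables (R : realType) (X : topologicalZmodType).

(** The outer measure of the translate of [A] by [- t] is at least the measure of
    [K a]. *)
Lemma translates_not_Haar_null (K : (nat -> nat) -> set X) (A : set X) :
  (forall mu : probability (borelType X) R,
     exists a, measurable (K a : set (borelType X)) /\ (0 < mu (K a))%E) ->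
  (forall a, exists t, forall k, K a k -> A (t + k)) -> ~ Haar_null R A.
Proof.
move=> KP KA [_ [mu mu0]]; have [a [mK K0]] := KP mu; have [t tA] := KA a.
have := mu0 (- t); apply/eqP; rewrite gt_eqF//.
apply: (lt_le_trans K0); rewrite -(measurable_mu_extE mu mK).
apply: le_mu_ext => k Kk; exists (t + k); first exact: tA.
by rewrite addKr.
Qed.

Lemma slalom_positive (V : (set X)^nat) (q : X^nat)
    (mu : probability (borelType X) R) :
  nbhs_chain V -> (forall (U : set X) (x : X), nbhs x U -> exists n, U (q n)) ->
  exists a, measurable (slalom V q a : set (borelType X)) /\
    (0 < mu (slalom V q a))%E.
Proof.
move=> VC qD.
have mD n k : measurable (net_nbhs V q n k : set (borelType X)).
  apply: sub_sigma_algebra.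
  rewrite (_ : net_nbhs _ _ _ _ = \bigcup_(u in [set u | (u <= k)%N])
     [set x | V (8 * n + 5)%N (x - q u)]); last first.
    by apply/seteqP; split => x [u]; exists u.
  apply: bigcup_open => u _.
  apply: (@open_comp _ _ (fun x => x - q u) (V (8 * n + 5)%N)).
    by move=> z _; exact: subr_continuous.
  exact: chain_open.
have [||a a0] := @ulam_selection _ _ R mu (net_nbhs V q) mD.
- move=> n k l kl; apply/subsetPset => x [u uk xu]; exists u => //.
  exact: leq_trans kl.
- move=> n; apply/seteqP; split => // x _.
  have [u xu] := qD _ _ (nbhs_subr x (chain_nbhs VC (8 * n + 5)%N)).
  by exists u => //; exists u => //; rewrite -opprB; exact: chainN.
by exists a; split => //; exact: bigcapT_measurable.
Qed.

End haar.

(** * The invariant set *)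

Lemma sigma_compact_invariant_Fsigma (R : realType) (X : topologicalZmodType)
    (X_polish : polish R X) (X_nlc : ~ locally_compact [set: X]) (G : set X) :
  zmod_closed (mem G) -> sigma_compact G ->
    exists F : set X, [/\ invariant_set G F, Fsigma F,
      ~ prevalent R F & ~ Haar_null R F].
Proof.
move=> [G0 GB] [K cK GK]; have [sX cX] := X_polish.
have [q qD] := separable_seq sX.
(* translates of [E U] do not finitely cover [U] *)
have /choice[E EP] : forall U : set X, exists W,
    nbhs 0 U -> nbhs 0 W /\ ~ fin_covered W U.
  move=> U; have [U0|] := pselect (nbhs 0 U); last by exists setT.
  by have [W] := nlc_not_fin_covered cX X_nlc U0; exists W.
have [V [VC VE]] := exists_chain cX (fun U U0 => (EP U U0).1).
have VS n : ~ fin_covered (V n.+1) (V n).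
  have [_ nE] := EP _ (chain_nbhs VC n); apply: contra_not nE => -[s sP].
  by exists s => c /sP[a sa Va]; exists a => //; exact: VE.
have [A [B [cA AB At Bt]]] := @separated_slaloms R X cX V q K VC VS cK.
have Gsub g h : G g -> G h -> G (g - h).
  by move=> Gg Gh; have := GB g h; rewrite !inE; apply.
have GN g : G g -> G (- g).
  by move=> Gg; rewrite -sub0r; apply: Gsub => //; move: G0; rewrite inE.
pose F := [set z | exists a g, [/\ A a, G g & z = a + g]].
exists F; split.
- move=> g Gg; apply/seteqP; split => z.
    move=> [_ [a [h [Aa Gh ->]]] <-]; exists a, (g + h); split => //.
      by rewrite -[h]opprK; apply: Gsub => //; exact: GN.
    by rewrite addrCA.
  move=> [a [h [Aa Gh ->]]]; exists (a + (h - g)); last first.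
    by rewrite addrCA [g + _]addrCA subrr addr0.
  by exists a, (h - g); split => //; exact: Gsub.
- exists (fun n => [set z | exists a g, [/\ A a, K n g & z = a + g]]).
    by move=> n; exact: closed_addr_compact.
  apply/seteqP; split => z.
    move=> [a [g [Aa]]]; rewrite GK => -[n _ Kg] ->.
    by exists n => //; exists a, g.
  move=> [n _ [a [g [Aa Kg ->]]]]; exists a, g; split => //.
  by rewrite GK; exists n.
- apply: (translates_not_Haar_null (K := slalom V q)).
    by move=> mu; exact: slalom_positive.
  move=> a; have [t tP] := Bt a; exists t => k /tP Btk [z [g [Az]]].
  by rewrite GK => -[n _ Kg] tkE; apply: (AB n z g) => //; rewrite -tkE.
- apply: (translates_not_Haar_null (K := slalom V q)).
    by move=> mu; exact: slalom_positive.
  move=> a; have [t tP] := At a; exists t => k /tP Atk.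
  exists (t + k), 0; split => //; last by rewrite addr0.
  by move: G0; rewrite inE.
Qed.

Theorem proposition12 (R : realType) (X : topologicalZmodType)
    (X_polish : polish R X) (X_nlc : ~ locally_compact [set: X]) :
  (forall G : set X, zmod_closed (mem G) -> sigma_compact G ->
    exists F : set X, [/\ invariant_set G F, Fsigma F,
      ~ prevalent R F & ~ Haar_null R F]) /\
  (forall G : set X, zmod_closed (mem G) -> countable G -> dense G ->
    exists F : set X, [/\ invariant_set G F, Fsigma F,
      ~ prevalent R F & ~ Haar_null R F]).
Proof.
have sc := sigma_compact_invariant_Fsigma X_polish X_nlc.
split => // G Gz cG _; apply: sc => //.
have /countable_injP[f finj] := cG.
exists (fun n => G `&` f @^-1` [set n]).
  move=> n; have [[g [Gg fg]]|ng] := pselect (exists g, G g /\ f g = n).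
    rewrite (_ : _ `&` _ = [set g]); first exact: compact_set1.
    apply/seteqP; split => [h [Gh fh]|_ ->//]; apply: finj; rewrite ?inE//.
    by rewrite fg.
  rewrite (_ : _ `&` _ = set0); first exact: compact0.
  by apply/seteqP; split => // h Gh; apply: ng; exists h.
by apply/seteqP; split => [g Gg|g [n _ []]//]; exists (f g).
Qed.
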